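(* Let $\{f_l\}_{l\in L}$ be an abstract pCFG with priority partition $\{P_{l,i}\}_{l\in L,1\le i\le d}$, and assume $\textsc{Solve}$ is complete, i.e. for any constraint sets $c_0,c_1$ it returns measurable functions satisfying all constraints in $c_0$, and satisfying at least one constraint in $c_1$ whenever some solution satisfying all of $c_0$ and at least one constraint of $c_1$ exists. If there exists a LexPMSM map for the pCFG, then the synthesis algorithm described in the context returns a LexPMSM map (i.e. it terminates and does not output ''no LexPMSM map found'').
   Context: Setting: an abstract pCFG is a family of Markov kernels $f_l:\mathbb{R}^n\to\mathcal{G}(L\times\mathbb{R}^n)$ ($L$ finite), inducing the Markov chain $F(l,x)=f_l(x)$ on $L\times\mathbb{R}^n$ with $(\mathbb{X}g)(s)=\int g\,dF_s$; a priority partition is a family of measurable $P_{l,i}\subseteq\mathbb{R}^n$ with $\{P_{l,i}\}_{i=1}^d$ a partition of $\mathbb{R}^n$ for each $l$. For a family $R=\{R_{l,i}:\mathbb{R}^n\to[0,\infty)\}$ let $\hat R(l,x)=\sum_i[x\in P_{l,i}]R_{l,i}(x)$. LexPMSM map: positive integers $m_j$ ($1\le j\le\lceil d/2\rceil$), $\mathrm{lev}:L\times\{1,\dots,d\}\to\mathbf{Lev}\cup\{\star\}$ with $\mathbf{Lev}=\{(j,k)\mid 1\le k\le m_j\}$ ordered lexicographically, and measurable $r_{(l,i),j,k}:\mathbb{R}^n\to[0,\infty)$, with $r_{j,k}=\widehat{\{r_{(l,i),j,k}\}_{l,i}}$, such that: if $\mathrm{lev}(l,i)=(j,k)$ then $j\le\lceil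 i/2\rceil$ and for all $x\in P_{l,i}$, $r_{j',k'}(l,x)\ge(\mathbb{X}r_{j',k'})(l,x)$ for all $(j',k')<_{\mathrm{lex}}(j,k)$ and $r_{j,k}(l,x)\ge1+(\mathbb{X}r_{j,k})(l,x)$; if $\mathrm{lev}(l,i)=\star$ then $i$ is even and $r_{j,k}(l,x)\ge(\mathbb{X}r_{j,k})(l,x)$ for all $j\le\lceil i/2\rceil$, $k\le m_j$, $x\in P_{l,i}$. Algorithm: set $T=L\times\{1,\dots,d\}$. For $j=1,\dots,\lceil d/2\rceil$: remove from $T$ all $(l,i)$ with $i<2j-1$; then repeat: let $c_0$ be the constraints ''$\forall x\in P_{l,i}$, $R_{l,i}(x)\ge(\mathbb{X}\hat R)(l,x)$'' for $(l,i)\in T$ together with $R_{l,i}\ge0$ on $P_{l,i}$ for all $(l,i)$, and $c_1$ the constraints ''$\forall x\in P_{l,i}$, $R_{l,i}(x)\ge1+(\mathbb{X}\hat R)(l,x)$'' for $(l,i)\in T$; let $R=\textsc{Solve}(c_0,c_1)$; let $T'$ be the set of $(l,i)\in T$ whose $c_1$-constraint $R$ satisfies; set $T\leftarrow T\setminus T'$; if $T'\neq\emptyset$, append $R$ as the next component of block $j$ and repeat; else stop the inner loop. After the inner loop, if some $(l,2j-1)$ remains in $T$, output ''no LexPMSM map found'' and stop; if block $j$ received no component, set $m_j=1$ and its single component to the zero function, else $m_j$ is the number of appended components. After all $j$, return the family $\{r_{(l,i),j,k}\}$. *)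

(* Defs.v *)
From HB Require Import structures.
From mathcomp Require Import all_boot all_order all_algebra.
From mathcomp Require Import all_classical all_reals all_analysis.

Set Implicit Arguments.
Unset Strict Implicit.
Unset Printing Implicit Defensive.

Import Order.TTheory GRing.Theory Num.Theory.

Local Open Scope classical_set_scope.
Local Open Scope ring_scope.

(* R^n is [n.-tuple R] with the product sigma-algebra (the one
   generated by the coordinates, i.e. the Borel one).

   Priorities, block indices j and component indices k are numbered from 1, as
   on paper; an element [i : 'I_d] stands for the priority [i.+1]. *)

Section LexPMSM.
Context {R : realType} {n d : nat} {dL : measure_display}
  {L : measurableType dL}.

Implicit Types (f : L -> R.-pker (n.-tuple R) ~> (L * n.-tuple R)%type)
  (P : L -> 'I_d -> set (n.-tuple R)).

Definition chain f (s : L * n.-tuple R) := f s.1 s.2.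

(* The operator written X on paper; extended-real valued, as the expectation may
   be infinite. *)
Definition nextE f (g : L * n.-tuple R -> R) (s : L * n.-tuple R) : \bar R :=
  (\int[chain f s]_t (g t)%:E)%E.

(* Blocks may be empty, which is why [classical_sets.partition] is not used. *)
Definition priority_partition P : Prop :=
  forall l, [/\ forall i, measurable (P l i),
                trivIset [set: 'I_d] (P l) &
                \bigcup_i P l i = [set: n.-tuple R]].

Definition rfamily := L -> 'I_d -> n.-tuple R -> R.

Definition nneg_measurable (Q : rfamily) : Prop :=
  forall l i, measurable_fun [set: n.-tuple R] (Q l i) /\
              forall x, 0 <= Q l i x.

Definition hat P (Q : rfamily) (s : L * n.-tuple R) : R :=
  \sum_(i < d) \1_(P s.1 i) s.2 * Q s.1 i s.2.

Definition Lev (m : nat -> nat) : set (nat * nat) :=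
  [set p | (1 <= p.1 <= uphalf d)%N /\ (1 <= p.2 <= m p.1)%N].

Definition lt_lex (p q : nat * nat) : bool := ((p : nat *l nat) < q)%O.

(* [lev l i = None] encodes the level [star]; [r j k l i] is r_((l,i),j,k),
   meaningful for (j, k) in [Lev m] only. *)
Definition LexPMSM_map f P (m : nat -> nat) (lev : L -> 'I_d -> option (nat * nat))
    (r : nat -> nat -> rfamily) : Prop :=
  [/\ forall j, (1 <= j <= uphalf d)%N -> (0 < m j)%N,
      forall l i p, lev l i = Some p -> Lev m p,
      forall j k, Lev m (j, k) -> nneg_measurable (r j k),
      forall l i j k, lev l i = Some (j, k) ->
        (j <= uphalf i.+1)%N /\
        forall x, P l i x ->
          (forall j' k', Lev m (j', k') -> lt_lex (j', k') (j, k) ->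
             (nextE f (hat P (r j' k')) (l, x) <= (hat P (r j' k') (l, x))%:E)%E) /\
          (1 + nextE f (hat P (r j k)) (l, x) <= (hat P (r j k) (l, x))%:E)%E &
      forall l i, lev l i = None ->
        ~~ odd i.+1 /\
        forall x j k, P l i x ->
          (1 <= j <= uphalf i.+1)%N -> (1 <= k <= m j)%N ->
          (nextE f (hat P (r j k)) (l, x) <= (hat P (r j k) (l, x))%:E)%E].

Inductive constraint : Type :=
| Nonneg of L & 'I_d
| NonIncr of L & 'I_d
| Decr of L & 'I_d.

Definition sat f P (Q : rfamily) (c : constraint) : Prop :=
  match c with
  | Nonneg l i => forall x, P l i x -> 0 <= Q l i x
  | NonIncr l i => forall x, P l i x ->
      (nextE f (hat P Q) (l, x) <= (Q l i x)%:E)%E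
  | Decr l i => forall x, P l i x ->
      (1 + nextE f (hat P Q) (l, x) <= (Q l i x)%:E)%E
  end.

Definition solver := set constraint -> set constraint -> rfamily.

(* Without the satisfiability proviso on [c0] no solver could be complete: some
   sets of [Decr] constraints have no solution at all. *)
Definition solver_complete f P (Solve : solver) : Prop :=
  forall c0 c1 : set constraint,
    (exists2 Q, nneg_measurable Q & c0 `<=` sat f P Q) ->
    [/\ nneg_measurable (Solve c0 c1),
        c0 `<=` sat f P (Solve c0 c1) &
        (exists Q, [/\ nneg_measurable Q, c0 `<=` sat f P Q &
                       exists2 c, c1 c & sat f P Q c]) ->
        exists2 c, c1 c & sat f P (Solve c0 c1) c].

Implicit Types T U : set (L * 'I_d).

Definition constraints0 T : set constraint :=
  [set NonIncr li.1 li.2 | li in T] `|`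
  [set Nonneg li.1 li.2 | li in [set: L * 'I_d]].

Definition constraints1 T : set constraint :=
  [set Decr li.1 li.2 | li in T].

Definition solution (Solve : solver) T : rfamily :=
  Solve (constraints0 T) (constraints1 T).

Definition ranked f P Solve T : set (L * 'I_d) :=
  [set li | T li /\ sat f P (solution Solve T) (Decr li.1 li.2)].

(* [inner_run f P Solve T b U]: the inner loop started with the set [T] terminates
   with the set [U], having appended the components [b], in this order. *)
Inductive inner_run f P Solve : set (L * 'I_d) -> seq rfamily ->
    set (L * 'I_d) -> Prop :=
| inner_stop T : ranked f P Solve T = set0 ->
    inner_run f P Solve T [::] (T `\` ranked f P Solve T)
| inner_repeat T b U : ranked f P Solve T !=set0 ->
    inner_run f P Solve (T `\` ranked f P Solve T) b U ->
    inner_run f P Solve T (solution Solve T :: b) U.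

Definition drop_below (j : nat) T : set (L * 'I_d) :=
  [set li | T li /\ (j.*2.-1 <= li.2.+1)%N].

Definition stuck (j : nat) T : Prop :=
  exists li, T li /\ li.2.+1 = j.*2.-1.

Definition zero_family : rfamily := fun _ _ _ => 0.

Definition close_block (b : seq rfamily) : seq rfamily :=
  if b is [::] then [:: zero_family] else b.

(* [outer_run f P Solve j T bs out]: from the beginning of the j-th iteration, with
   set [T] and blocks [bs] already built, the algorithm terminates with [out];
   [None] is the output "no LexPMSM map found". *)
Inductive outer_run f P Solve : nat -> set (L * 'I_d) -> seq (seq rfamily) ->
    option (seq (seq rfamily)) -> Prop :=
| outer_return j T bs : (uphalf d < j)%N ->
    outer_run f P Solve j T bs (Some bs)
| outer_fail j T bs b U : (j <= uphalf d)%N ->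
    inner_run f P Solve (drop_below j T) b U -> stuck j U ->
    outer_run f P Solve j T bs None
| outer_next j T bs b U out : (j <= uphalf d)%N ->
    inner_run f P Solve (drop_below j T) b U -> ~ stuck j U ->
    outer_run f P Solve j.+1 U (rcons bs (close_block b)) out ->
    outer_run f P Solve j T bs out.

Definition synthesis f P Solve : option (seq (seq rfamily)) -> Prop :=
  outer_run f P Solve 1 [set: L * 'I_d] [::].

Definition block_size (bs : seq (seq rfamily)) (j : nat) : nat :=
  size (nth [::] bs j.-1).

Definition component (bs : seq (seq rfamily)) (j k : nat) : rfamily :=
  nth zero_family (nth [::] bs j.-1) k.-1.

Lemma inner_inv f P Solve T b U : inner_run f P Solve T b U ->
  (ranked f P Solve T = set0 /\ b = [::] /\ U = T `\` ranked f P Solve T) \/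
  (ranked f P Solve T !=set0 /\ exists2 b', b = solution Solve T :: b' &
     inner_run f P Solve (T `\` ranked f P Solve T) b' U).
Proof. by case=> [{}T T0|{}T {}b {}U Tn H]; [left|right; split=> //; exists b]. Qed.

Lemma outer_inv f P Solve j T bs out : outer_run f P Solve j T bs out ->
  ((uphalf d < j)%N /\ out = Some bs) \/
  ((j <= uphalf d)%N /\ exists b U, inner_run f P Solve (drop_below j T) b U /\
    (stuck j U /\ out = None \/
     ~ stuck j U /\ outer_run f P Solve j.+1 U (rcons bs (close_block b)) out)).
Proof.
case=> {j T bs out} [j T bs dj|j T bs b U jd HU s|j T bs b U out jd HU s H].
- by left.
- by right; split=> //; exists b, U; split=> //; left.
- by right; split=> //; exists b, U; split=> //; right.
Qed.

Lemma inner_fun f P Solve T b U b' U' :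
  inner_run f P Solve T b U -> inner_run f P Solve T b' U' -> b = b' /\ U = U'.
Proof.
move=> H; elim: H b' U' => {T b U} [T T0|T b U Tn _ IH] b' U' /inner_inv.
  by case=> [[_ [-> ->]]//|[[y]]]; rewrite T0.
by case=> [[T0]|[_ [b1 -> /IH[-> ->]]]]//; case: Tn => y; rewrite T0.
Qed.

Lemma synthesis_fun f P Solve out out' :
  synthesis f P Solve out -> synthesis f P Solve out' -> out = out'.
Proof.
rewrite /synthesis; move: 1%N [set: _] [::] => j T bs H.
elim: H out' => {j T bs out}
  [j T bs dj|j T bs b U jd HU s|j T bs b U out jd HU s _ IH] out' /outer_inv.
- by case=> [[_ ->]//|[jd]]; rewrite ltnNge jd in dj.
- case=> [[dj]|[_ [b1 [U1 [/(inner_fun HU)[<- <-]]]]]].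
    by rewrite ltnNge jd in dj.
  by case=> [[_ ->]|[]].
- case=> [[dj]|[_ [b1 [U1 [/(inner_fun HU)[<- <-]]]]]].
    by rewrite ltnNge jd in dj.
  by case=> [[]//|[_ /IH]].
Qed.

End LexPMSM.

Arguments constraint {d dL} L.
Arguments rfamily R n d {dL} L.
Arguments solver R n d {dL} L.

(* Main.v *)
Require Import Defs.
From mathcomp Require Import all_boot all_order all_algebra.
From mathcomp Require Import finmap.
From mathcomp Require Import all_classical all_reals all_analysis.

(** The components found by the algorithm are sound by construction: a pair is
    non-increasing for every component computed while it is in the working set,
    it leaves that set either by decreasing (which fixes its level) or at the
    start of a block. Only pairs of even priority leave in the latter way or
    remain at the end, and they get level star. Failure is excluded by comparison with the given map:
    after block j no remaining pair has an original level in a block up to j,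
    whereas a pair of odd priority 2j-1 has such a level. *)

Local Open Scope classical_set_scope.
Local Open Scope ring_scope.

Section Completeness.

Set Implicit Arguments.
Unset Strict Implicit.
Import Order.TTheory GRing.Theory Num.Theory.

Context {R : realType} {n d : nat} {dL : measure_display}
  {L : measurableType dL}.
Context {f : L -> R.-pker (n.-tuple R) ~> (L * n.-tuple R)%type}
  {P : L -> 'I_d -> set (n.-tuple R)} {Solve : solver R n d L}.

Implicit Types (Q : rfamily R n d L) (T U : set (L * 'I_d))
  (b : seq (rfamily R n d L)) (bs : seq (seq (rfamily R n d L))).

Let z : rfamily R n d L := zero_family.

(** * The partition, the zero family and the solver *)

Lemma hatE Q l i x : priority_partition P -> P l i x -> hat P Q (l, x) = Q l i x.
Proof.
move=> /(_ l)[_ trivP _] Pix; rewrite /hat /= (bigD1 i)//= big1 => [|k ki].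
  by rewrite indicE mem_set// mul1r addr0.
rewrite indicE memNset ?mul0r// => Pkx.
by move/eqP: ki; apply; apply: trivP => //; exists x.
Qed.

Lemma nextE_hat_zero s : Defs.nextE f (hat P z) s = 0%E.
Proof.
rewrite /nextE; apply: integral0_eq => t _; congr (_%:E).
by apply: big1 => i _; rewrite mulr0.
Qed.

Lemma zero_nneg_measurable : nneg_measurable z.
Proof. by move=> l i; split => [|x]; [exact: measurable_cst | exact: lexx]. Qed.

(** This makes [constraints0 T] satisfiable for every [T], and lets the zero family serve as a
    harmless default component beyond the end of a list. *)
Lemma sat_NonIncr_zero l i : sat f P z (NonIncr l i).
Proof. by move=> x _; rewrite nextE_hat_zero. Qed.

Lemma solution_spec T : solver_complete f P Solve ->
  nneg_measurable (solution Solve T) /\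
  forall li, T li -> sat f P (solution Solve T) (NonIncr li.1 li.2).
Proof.
move=> cS; have [|? c0S _] := cS (constraints0 T) (constraints1 T).
  exists z; first exact: zero_nneg_measurable.
  by move=> _ [[li _ <-]|[li _ <-]]; [exact: sat_NonIncr_zero | move=> x _ /=].
by split => // li Tli; apply: c0S; left; exists li.
Qed.

(** Brings completeness to bear on the stopping test: once [ranked] is empty, no family feasible for
    [T] can decrease at a pair of [T]. *)
Lemma ranked_neq0 T Q li : solver_complete f P Solve -> nneg_measurable Q ->
  (forall li', T li' -> sat f P Q (NonIncr li'.1 li'.2)) ->
  T li -> sat f P Q (Decr li.1 li.2) -> ranked f P Solve T !=set0.
Proof.
move=> cS mQ QT Tli Qli.
have c0Q : constraints0 T `<=` sat f P Q.
  by move=> _ [[li' /QT + <-]//|[li' _ <-] x _]; have [] := mQ li'.1 li'.2.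
have [|_ _ []] := cS (constraints0 T) (constraints1 T); first by exists Q.
  by exists Q; split=> //; exists (Decr li.1 li.2) => //; exists li.
by move=> _ [li' Tli' <-] ?; exists li'.
Qed.

(** * The inner loop *)

(** There are finitely many pairs, and every repetition removes at least one. *)
Lemma inner_terminates T : finite_set [set: L] ->
  exists b U, inner_run f P Solve T b U.
Proof.
move=> finL.
have finT A : finite_set (A : set (L * 'I_d)).
  apply: (@sub_finite_set _ _ ([set: L] `*` [set: 'I_d])) => //.
  by apply: finite_setX => //; exact: finite_finset.
have [N] := ubnP #|` fset_set T|; elim: N T => // N IH T TN.
have [T0|/set0P Tn] := eqVneq (ranked f P Solve T) set0.
  by do 2!eexists; exact: inner_stop.
have [|b [U HU]] := IH (T `\` ranked f P Solve T); last first.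
  by do 2!eexists; exact: inner_repeat HU.
rewrite -ltnS (leq_trans _ TN)// ltnS fproper_ltn_card// fproperE.
apply/andP; split; first by rewrite -fset_set_sub//; exact: subDsetl.
apply/negP; rewrite -fset_set_sub// => TD.
by have [li rli] := Tn; have [_] := TD li (proj1 rli).
Qed.

(** Indices past the end of [b] read the zero family, so measurability and [NonIncr] on [U] can be
    claimed for every [k]. *)
Lemma inner_sound T b U : solver_complete f P Solve ->
  inner_run f P Solve T b U ->
  [/\ ranked f P Solve U = set0, U `<=` T,
      forall k, nneg_measurable (nth z b k),
      forall li, U li -> forall k, sat f P (nth z b k) (NonIncr li.1 li.2) &
      forall li, T li -> ~ U li ->
        exists k, [/\ (k < size b)%N, sat f P (nth z b k) (Decr li.1 li.2) &
          forall k', (k' < k)%N -> sat f P (nth z b k') (NonIncr li.1 li.2)]].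
Proof.
move=> cS; elim=> {T b U} [T T0|T b U _ _ [U0 UT mb bU bT]].
  rewrite T0 setD0; split => // [k|li _ k]; rewrite nth_nil.
    exact: zero_nneg_measurable.
  exact: sat_NonIncr_zero.
have [mS ST] := solution_spec T cS; split => //.
- by move=> li /UT[].
- by case.
- by move=> li Uli [|k] /=; [apply: ST; case: (UT li Uli) | exact: bU].
- move=> li Tli nUli; have [rli|nrli] := pselect (ranked f P Solve T li).
    by exists 0%N; split => //; case: rli.
  have [|k [kb Dk Nk]] := bT li _ nUli; first by split.
  exists k.+1; split => // -[_|k'] /=; [exact: ST | exact: Nk].
Qed.

(** * The outer loop: its invariant and the comparison with the given map *)

(** Since the default is already [z], filling an empty block changes nothing that is read. *)
Lemma nth_close_block b k : nth z (close_block b) k = nth z b k.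
Proof. by case: b k => // -[|[|k]]. Qed.

(** Unfolds to [component bs j.+1 k.+1]. *)
Definition comp bs j k : rfamily R n d L := nth z (nth [::] bs j) k.

(* Block and component indices are 0-based here; the two cases correspond to a
   level [(j.+1, k.+1)] and to the level star. *)
Definition settled bs (li : L * 'I_d) : Prop :=
  (exists j k, [/\ (j < size bs)%N, (k < size (nth [::] bs j))%N,
      (j < uphalf li.2.+1)%N, sat f P (comp bs j k) (Decr li.1 li.2) &
      forall j' k', (j' < j)%N \/ j' = j /\ (k' < k)%N ->
        sat f P (comp bs j' k') (NonIncr li.1 li.2)]) \/
  [/\ ~~ odd li.2.+1, (uphalf li.2.+1 <= size bs)%N &
      forall j k, (j < uphalf li.2.+1)%N ->
        sat f P (comp bs j k) (NonIncr li.1 li.2)].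

(** Invariant between blocks. After block j the least remaining priority is 2j: those below 2j-1
    were dropped, and 2j-1 itself would have been stuck. *)
Definition sound_state T bs : Prop :=
  [/\ forall j, (j < size bs)%N -> (0 < size (nth [::] bs j))%N,
      forall j k, nneg_measurable (comp bs j k),
      forall li, T li -> ((size bs).*2 <= li.2.+1)%N /\
        forall j k, sat f P (comp bs j k) (NonIncr li.1 li.2) &
      forall li, ~ T li -> settled bs li].

Lemma comp_rcons bs b j k : comp (rcons bs b) j k =
  if (j < size bs)%N then comp bs j k
  else if j == size bs then nth z b k else z.
Proof.
rewrite /comp nth_rcons; case: ifP => // _; case: ifP => // _.
by rewrite nth_nil.
Qed.

(** Level star concerns only blocks up to half the priority, and the size condition in [settled]
    says that these are already built. *)
Lemma settled_rcons bs b li : settled bs li -> settled (rcons bs b) li.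
Proof.
case=> [[j [k [jbs kj ji Dk Nk]]]|[ev isz N]]; [left|right].
  exists j, k; rewrite nth_rcons comp_rcons size_rcons jbs.
  split => // [|j' k' lt]; first exact: ltnW.
  rewrite comp_rcons ifT; first exact: Nk.
  by case: lt => [/ltn_trans|[->]//]; apply.
rewrite size_rcons; split => // [|j k ji]; first exact: leqW.
by rewrite comp_rcons (leq_trans ji)//; exact: N.
Qed.

Lemma sound_step T bs b U : solver_complete f P Solve -> sound_state T bs ->
  inner_run f P Solve (drop_below (size bs).+1 T) b U ->
  ~ stuck (size bs).+1 U -> sound_state U (rcons bs (close_block b)).
Proof.
move=> cS [ne mbs bsT bsN] /(inner_sound cS)[_ UT mb bU bT] nst.
split.
- move=> j; rewrite size_rcons ltnS nth_rcons => jbs.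
  have [/ne//|bj] := ltnP j (size bs).
  by rewrite eqn_leq jbs bj; case: (b).
- move=> j k; rewrite comp_rcons; case: ifP => // _; case: ifP => // _.
    by rewrite nth_close_block.
  exact: zero_nneg_measurable.
- move=> li Uli; have [Tli] := UT li Uli.
  rewrite doubleS /= => ge; split.
    rewrite size_rcons doubleS ltn_neqAle ge andbT; apply/eqP => e.
    by apply: nst; exists li; rewrite doubleS -e.
  move=> j k; rewrite comp_rcons; case: ifP => _; first exact: (bsT li Tli).2.
  case: ifP => _; last exact: sat_NonIncr_zero.
  by rewrite nth_close_block; exact: bU.
- move=> li nUli; have [Tli|/bsN] := pselect (T li); last exact: settled_rcons.
  have [ge bsli] := bsT li Tli.
  (* A pair dropped at the start of this block has priority exactly [(size bs).*2], which is even,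
     so it gets level star; any other pair leaving now is ranked in the new block. *)
  have [lt|ge'] := ltnP li.2.+1 (size bs).*2.+1.
    have e : li.2.+1 = (size bs).*2 by apply/eqP; rewrite eqn_leq ge andbT.
    apply: settled_rcons; right; rewrite e odd_double uphalf_double.
    by split => // j k _; exact: bsli.
  have [|k [kb Dk Nk]] := bT li _ nUli; first by split => //; rewrite doubleS.
  left; exists (size bs), k.
  rewrite size_rcons nth_rcons comp_rcons ltnn eqxx nth_close_block.
  split => //.
  + by case: (b) kb => [|? ?].
  + by rewrite gtn_uphalf_double.
  + move=> j' k'; rewrite comp_rcons => -[->|[-> k'k]]; first exact: bsli.
    by rewrite ltnn eqxx nth_close_block; exact: Nk.
Qed.

(* For the least k such that some element of U has original level (j, k), the
   component r j k is feasible for U and decreases there, so completeness of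
   Solve would make another round of the inner loop succeed. *)
Lemma exhausts (m : nat -> nat) lev r j U : priority_partition P ->
  solver_complete f P Solve ->
  LexPMSM_map f P m lev r -> ranked f P Solve U = set0 ->
  (forall li, U li -> (j.*2.-1 <= li.2.+1)%N) ->
  (forall li p, U li -> lev li.1 li.2 = Some p -> (j <= p.1)%N) ->
  forall li p, U li -> lev li.1 li.2 = Some p -> (j < p.1)%N.
Proof.
move=> part cS [_ levP mr dec star] U0 jU levU li p Uli lip.
rewrite ltn_neqAle (levU _ _ Uli lip) andbT; apply/negP => /eqP jp.
pose at_level k := `[< exists2 li', U li' & lev li'.1 li'.2 = Some (j, k) >].
have : exists k, at_level k.
  by exists p.2; apply/asboolP; exists li => //; rewrite lip jp; case: (p).
move=> /ex_minnP[k /asboolP[li0 Uli0 lev0] min_k].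
have Ljk := levP _ _ _ lev0.
have : ranked f P Solve U !=set0; last by rewrite U0 => -[].
apply: (@ranked_neq0 U (r j k) li0) => //; first exact: mr.
- move=> [l i] Uli' x Px /=; have := Ljk => -[/= /andP[j1 _] km].
  rewrite -(hatE _ part Px).
  case e : (lev l i) => [[j' k']|]; last first.
    have [_] := star l i e; apply=> //; rewrite j1 andTb geq_uphalf_double.
    by have := jU _ Uli'; case: (j).
  have [_ /(_ _ Px)[lower here]] := dec l i j' k' e.
  (* In block j, minimality of k leaves either the level (j, k) itself, where decrease implies
     non-increase, or a larger k'; in a later block (j, k) is lexicographically below. *)
  have := levU _ _ Uli' e; rewrite leq_eqVlt => /orP[/eqP/= jj|/= jj].
    have : (k <= k')%N.
      by apply: min_k; apply/asboolP; exists (l, i); rewrite // e jj.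
    rewrite leq_eqVlt => /orP[/eqP kk|kk].
      by rewrite jj kk; apply: le_trans here; rewrite leeDr.
    apply: lower => //; rewrite /lt_lex Order.ProdLexiOrder.ltEprodlexi /=.
    by rewrite -jj lexx.
  apply: lower => //; rewrite /lt_lex Order.ProdLexiOrder.ltEprodlexi /=.
  by rewrite leEnat (ltnW jj) /= leqNgt jj.
- move: li0 Uli0 lev0 => [l0 i0] _ lev0 x Px /=.
  rewrite -(hatE _ part Px).
  by have [_ /(_ _ Px)[]] := dec _ _ _ _ lev0.
Qed.

(** * Reading off the levels, and the run of the algorithm *)

Lemma sound_state_map T bs : priority_partition P -> size bs = uphalf d ->
  sound_state T bs ->
  exists lev, LexPMSM_map f P (block_size bs) lev (component bs).
Proof.
move=> part sz [ne mbs bsT bsN].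
have settles li : settled bs li.
  have [/bsT[]|/bsN//] := pselect (T li).
  rewrite sz => ge N; right.
  (* A pair never removed has priority at least [(uphalf d).*2], but at most [d]; hence equality,
     and the priority is even. *)
  have e : li.2.+1 = (uphalf d).*2.
    apply/eqP; rewrite eqn_leq ge andbT (leq_trans (ltn_ord li.2))//.
    by rewrite -leq_uphalf_double.
  by rewrite e odd_double uphalf_double sz; split => // j k _; exact: N.
(* The requirements on the level of a single pair, so that [lev] can be chosen pair by pair. *)
pose good (li : L * 'I_d) (o : option (nat * nat)) := match o with
  | Some (j, k) => [/\ @Lev d (block_size bs) (j, k), (j <= uphalf li.2.+1)%N,
      sat f P (component bs j k) (Decr li.1 li.2) &
      forall j' k', @Lev d (block_size bs) (j', k') -> lt_lex (j', k') (j, k) ->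
        sat f P (component bs j' k') (NonIncr li.1 li.2)]
  | None => ~~ odd li.2.+1 /\ forall j k, (1 <= j <= uphalf li.2.+1)%N ->
      (1 <= k)%N -> sat f P (component bs j k) (NonIncr li.1 li.2)
  end.
have /choice[lev levP] : forall li, exists o, good li o.
  move=> li; case: (settles li) => [[j [k [jbs kj ji Dk Nk]]]|[ev _ N]].
    exists (Some (j.+1, k.+1)); split => //.
      by split => //=; rewrite -sz.
    move=> [|j'] [|k'] [] //= _ _.
    rewrite /lt_lex Order.ProdLexiOrder.ltEprodlexi /= !leEnat ltEnat /= !ltnS.
    move=> /andP[le lek]; apply: Nk.
    have [lt|ge] := ltnP j' j; first by left.
    right; split; first by apply/eqP; rewrite eqn_leq le.
    by move: lek; rewrite ge.
  by exists None; split => // -[|j] [|k] //= ji _; exact: N.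
exists (fun l i => lev (l, i)); split.
- by move=> [|j]//= jd; apply: ne; rewrite sz.
- by move=> l i [j k] e; have := levP (l, i); rewrite /good e => -[].
- by move=> [|j] [|k] [] // _ _; exact: mbs.
- move=> l i j k e; have := levP (l, i); rewrite /good e => -[_ ji Dk Nk].
  split => // x Px; rewrite !(hatE _ part Px); split; last exact: Dk.
  by move=> j' k' Lj lt; rewrite (hatE _ part Px); exact: (Nk _ _ Lj lt).
- move=> l i e; have := levP (l, i); rewrite /good e => -[ev N].
  split => // x j k Px ji /andP[k1 _]; rewrite (hatE _ part Px).
  exact: (N _ _ ji k1).
Qed.

(** Induction on the number of blocks still to be built; [exhausts] advances the bound on original
    levels by one block each time. *)
Lemma synthesis_progress (m : nat -> nat) lev r T bs : finite_set [set: L] ->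
  priority_partition P -> solver_complete f P Solve ->
  LexPMSM_map f P m lev r -> (size bs <= uphalf d)%N -> sound_state T bs ->
  (forall li p, T li -> lev li.1 li.2 = Some p -> (size bs < p.1)%N) ->
  exists bs', [/\ outer_run f P Solve (size bs).+1 T bs (Some bs'),
    size bs' = uphalf d & exists T', sound_state T' bs'].
Proof.
move=> finL part cS mapr.
have [N] := ubnP (uphalf d - size bs); elim: N T bs => // N IH T bs dN szd sT levT.
have [ge|lt] := leqP (uphalf d) (size bs).
  exists bs; split; [exact: outer_return | | by exists T].
  by apply/eqP; rewrite eqn_leq szd.
have [b [U HU]] := inner_terminates (drop_below (size bs).+1 T) finL.
have [U0 UT _ _ _] := inner_sound cS HU.
have levU : forall li p, U li -> lev li.1 li.2 = Some p -> ((size bs).+1 < p.1)%N.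
  apply: (exhausts part cS mapr U0) => li; first by case/UT.
  by move=> p /UT[Tli _]; exact: levT.
(* An odd priority forces an original level, in a block at most (size bs).+1 *)
have nst : ~ stuck (size bs).+1 U.
  move=> [[l i] [Uli]]; rewrite [_.2]/= doubleS [RHS]/= => e; have [_ _ _ dec star] := mapr.
  case el : (lev l i) => [[j k]|]; last first.
    by have [] := star _ _ el; rewrite e oddS odd_double.
  have [ji _] := dec _ _ _ _ el.
  have := levU _ _ Uli el; rewrite ltnNge (leq_trans ji)//.
  by rewrite leq_uphalf_double e doubleS.
have := sound_step cS sT HU nst.
set bs1 := rcons _ _ => sU.
have sz1 : size bs1 = (size bs).+1 by rewrite size_rcons.
have [||//||bs' [run sz' sound]] := IH U bs1.
- by rewrite sz1 -ltnS (leq_trans _ dN)// ltnS subnS ltn_predL subn_gt0.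
- by rewrite sz1.
- by rewrite sz1.
exists bs'; split => //; apply: outer_next HU nst _ => //.
by rewrite sz1 in run.
Qed.

End Completeness.

Theorem theorem6p8 (R : realType) (n d : nat)
    (dL : measure_display) (L : measurableType dL)
    (L_finite : finite_set [set: L])
    (L_discrete : forall A : set L, measurable A)
    (f : L -> R.-pker (n.-tuple R) ~> (L * n.-tuple R)%type)
    (P : L -> 'I_d -> set (n.-tuple R))
    (P_partition : priority_partition P)
    (Solve : solver R n d L)
    (Solve_complete : solver_complete f P Solve)
    (map_exists : exists m lev r, LexPMSM_map f P m lev r) :
  exists2 bs : seq (seq (rfamily R n d L)),
    synthesis f P Solve (Some bs) &
    exists lev, LexPMSM_map f P (block_size bs) lev (component bs).
Proof.
have [m [lev [r mapr]]] := map_exists.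
have [_ levP _ _ _] := mapr.
have [//|||bs [run sz [T sT]]] :=
  @synthesis_progress R n d dL L f P Solve m lev r [set: L * 'I_d] [::]
    L_finite P_partition Solve_complete mapr.
(* Before the first block every component read is the zero family, and no pair lies outside [T]. *)
- split => // [j k|li _|li []]; rewrite ?/comp ?nth_nil //.
    exact: zero_nneg_measurable.
  by split => // j k; rewrite /comp !nth_nil; exact: sat_NonIncr_zero.
- by move=> li p _ /levP[/andP[]].
exists bs => //; exact: sound_state_map P_partition sz sT.
Qed.
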